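(* Let $r\ge 0$ be a real number, let $l=\{a_i\,;\,i=1,2,3,\ldots\}$ be a bounded sequence of real numbers and let $m$ be a number such that $|a_i|<m$ for all $i\in N$. If a real number $a$ is an $r$-statistical limit of $l$, then $a$ is a $u$-limit of the sequence $\mu(l)$ of partial averages of $l$, where $u=(m+|a|)r$.
   Context: $N=\{1,2,3,\ldots\}$. For a real number $r\ge 0$ and a sequence $(x_n)$ of real numbers, a real number $x$ is an $r$-limit of $(x_n)$, written $x=r\text{-}\lim_{n\to\infty}x_n$, if for every $\varepsilon>0$ one has $|x_n-x|<r+\varepsilon$ for all but finitely many $n$ (an $r$-limit need not be unique). For a real sequence $l=\{a_i\}$, a real number $a$ is an $r$-statistical limit of $l$, written $a=r\text{-}stat\text{-}\lim l$, if for every $\varepsilon>0$ the number $0$ is an $r$-limit of the sequence $\frac1n|\{i\in N: i\le n,\ |a_i-a|\ge\varepsilon\}|$, $n=1,2,3,\ldots$ (here $|B|$ is the cardinality of a finite set $B$). The sequence of partial averages (means) of $l$ is $\mu(l)=\{\mu_n\,;\,n=1,2,3,\ldots\}$ with $\mu_n=\frac1n\sum_{i=1}^n a_i$. *)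

(* Defs.v *)
From mathcomp Require Import all_boot all_order all_algebra.
From mathcomp Require Import all_classical all_reals all_analysis.

Set Implicit Arguments.
Unset Strict Implicit.
Unset Printing Implicit Defensive.

Import Order.TTheory GRing.Theory Num.Theory.
Import numFieldNormedType.Exports.

Local Open Scope classical_set_scope.
Local Open Scope ring_scope.

(* Sequences are indexed by N = {1, 2, 3, ...}: the value at index 0 of a
   function nat -> R is never used. In particular "for all but finitely many n"
   is the filter \oo on nat, which is insensitive to the index 0. *)

Definition r_limit (R : realType) (r : R) (x : R^nat) (b : R) : Prop :=
  forall e : R, 0 < e -> \forall n \near \oo, `|x n - b| < r + e.

Definition deviation_freq (R : realType) (l : R^nat) (a e : R) : R^nat :=
  fun n => n%:R^-1 *
    #|[set i : 'I_n.+1 | (0 < i)%N && (e <= `|l i - a|)]%SET|%:R.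

Definition r_stat_limit (R : realType) (r : R) (l : R^nat) (a : R) : Prop :=
  forall e : R, 0 < e -> r_limit r (deviation_freq l a e) 0.

Definition partial_mean (R : realType) (l : R^nat) : R^nat :=
  fun n => n%:R^-1 * \sum_(1 <= i < n.+1) l i.

(* Main.v *)
Require Import Defs.
From mathcomp Require Import all_boot all_order all_algebra.
From mathcomp Require Import all_classical all_reals all_analysis.
From mathcomp Require Import lra.

Import Order.TTheory GRing.Theory Num.Theory.
Import numFieldNormedType.Exports.

Local Open Scope classical_set_scope.
Local Open Scope ring_scope.

(** The mean deviation |mu_n - a| is at most the mean of the |a_i - a|.
    Fix a threshold d > 0.  An index whose term is within d of a contributes
    less than d to that mean; any other index contributes at most
    K = m + |a|, by the triangle inequality.  Hence
    |mu_n - a| <= d + K f_n, where f_n is the frequency, among the first n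
    indices, of the terms at distance at least d from a; this is
    [partial_mean_dist_le].  Statistical convergence makes f_n eventually
    smaller than r + e' for every e' > 0, and the choice d = e / 2,
    e' = e / (2 K) bounds the right-hand side by K r + e. *)

(** Turning the cardinal into a sum of indicators makes the frequency a mean,
    which can be compared with [partial_mean] term by term. *)
Lemma deviation_freqE (R : realType) (l : R^nat) (a d : R) (n : nat) :
  deviation_freq l a d n =
  n%:R^-1 * \sum_(1 <= i < n.+1) (d <= `|l i - a|)%R%:R.
Proof.
rewrite /deviation_freq -sum1_card natr_sum; congr (_ * _).
rewrite [RHS]big_nat_cond big_mkcond [RHS]big_mkcond /=.
rewrite [RHS](big_addn 0%N n.+1 1%N) subn1 /= big_mkord.
rewrite big_ord_recl inE /= add0r; apply: eq_bigr => i _.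
rewrite inE /= addn1 /bump leq0n add1n /= !ltnS ltn_ord /=.
by case: (d <= _).
Qed.

Lemma deviation_freq_ge0 (R : realType) (l : R^nat) (a d : R) (n : nat) :
  0 <= deviation_freq l a d n.
Proof. by rewrite mulr_ge0 ?invr_ge0. Qed.

Lemma partial_mean_sub (R : realType) (l : R^nat) (a : R) (n : nat) :
  (0 < n)%N ->
  partial_mean l n - a = n%:R^-1 * \sum_(1 <= i < n.+1) (l i - a).
Proof.
move=> n_gt0; rewrite sumrB mulrBr sumr_const_nat subn1 /=.
by rewrite -[a *+ n]mulr_natl mulKf // pnatr_eq0 -lt0n.
Qed.

(** The two kinds of indices are handled at once by the pointwise bound
    |l i - a| <= d + K [d <= |l i - a|], which is then averaged. *)
Lemma partial_mean_dist_le (R : realType) (l : R^nat) (a d K : R) (n : nat) :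
  0 <= d -> (forall i, (0 < i)%N -> `|l i - a| <= K) -> (0 < n)%N ->
  `|partial_mean l n - a| <= d + K * deviation_freq l a d n.
Proof.
move=> d_ge0 distK n_gt0.
have n_neq0 : n%:R != 0 :> R by rewrite pnatr_eq0 -lt0n.
rewrite partial_mean_sub // deviation_freqE normrM ger0_norm ?invr_ge0 //.
rewrite mulrCA -[leRHS](mulKf n_neq0) mulrDr mulVKf //.
rewrite ler_wpM2l ?invr_ge0 //.
apply: le_trans (ler_norm_sum _ _ _) _.
have -> : n%:R * d = \sum_(1 <= i < n.+1) d.
  by rewrite sumr_const_nat subn1 /= mulr_natl.
rewrite mulr_sumr -big_split /= !big_nat; apply: ler_sum => i /andP[i_gt0 _].
case: (leP d) => [_|/ltW]; last by rewrite mulr0 addr0.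
by rewrite mulr1 (le_trans (distK _ i_gt0)) // lerDr.
Qed.

Theorem theorem3p1 (R : realType) (r : R) (l : R^nat) (m a : R)
    (r_ge0 : 0 <= r)
    (l_bounded : [bounded l i | i in [set i : nat | (0 < i)%N]])
    (l_lt_m : forall i : nat, (0 < i)%N -> `|l i| < m)
    (l_stat : r_stat_limit r l a) :
  r_limit ((m + `|a|) * r) (partial_mean l) a.
Proof.
move=> e e_gt0; set K := m + `|a|.
have m_gt0 : 0 < m by apply: le_lt_trans (l_lt_m 1%N isT).
have K_gt0 : 0 < K by rewrite ltr_wpDr.
have distK i : (0 < i)%N -> `|l i - a| <= K.
  by move=> /l_lt_m/ltW lm; rewrite (le_trans (ler_normB _ _)) // lerD2r.
have d_gt0 : 0 < e / 2 by rewrite divr_gt0.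
have e'_gt0 : 0 < e / 2 / K by rewrite divr_gt0.
have freq_small := l_stat _ d_gt0 _ e'_gt0.
near=> n.
have n_gt0 : (0 < n)%N by near: n; exact: nbhs_infty_gt.
apply: le_lt_trans (partial_mean_dist_le _ _ _ _ _ _ (ltW d_gt0) distK n_gt0) _.
have : `|deviation_freq l a (e / 2) n - 0| < r + e / 2 / K by near: n.
rewrite subr0 ger0_norm ?deviation_freq_ge0 // -(ltr_pM2l K_gt0).
rewrite mulrDr [K * (_ / K)]mulrC divfK ?gt_eqF //.
by move=> freq_lt; lra.
Unshelve. all: by end_near. Qed.
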